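(* Let $\gamma<0$ and $\Psi_\gamma(x)=(1-|x|^{-\gamma})\mathbb{1}_{[-1,0]}(x)+\mathbb{1}_{(0,\infty)}(x)$. Let $(\mathcal{M},\tau)$ be a tracial $W^*$-probability space, let $\{X_i\}_{i\ge 1}$ be freely independent self-adjoint operators affiliated with $\mathcal{M}$, all having the same spectral distribution function $U$, and let $a_n>0$, $b_n\in\mathbb{R}$ be such that the spectral distribution functions $F_{W_n}$ of $$W_n=\frac{X_1\lor\cdots\lor X_n-b_n}{a_n}$$ converge weakly to $\Psi_\gamma$ as $n\to\infty$. Assume that for each $n\ge 2$ the random variable $W_n$ has a density $u_n$ with respect to Lebesgue measure on $\mathbb{R}$ such that, with $\rho_n:=(\log u_n)'$: (i) $\mathrm{supp}(u_n)=[A_n,B_n]$ for some $-\infty<A_n<B_n\le 0$; (ii) $\lim_{t\to A_n+0}|t|\,u_n(t)$ exists in $[0,\infty)$ and $\lim_{t\to B_n-0}t\,u_n(t)=0$; (iii) $u_n$ is differentiable on $(A_n,B_n)$; (iv) $t\mapsto t\rho_n(t)$ is bounded and continuous on $(A_n,B_n)$. Then for each $n\ge 2$, $$d_K(F_{W_n},\Psi_\gamma)\le \tau\big(|1+\gamma^{-1}(1+W_n\rho_n(W_n))|\big)+\gamma^{-1}A_n\big\{1-(|A_n|\wedge |A_n|^{-1})^{-\gamma}\big\}u_n(A_n+).$$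
   Context: A tracial $W^*$-probability space $(\mathcal{M},\tau)$ is a von Neumann algebra $\mathcal{M}$ (acting on a Hilbert space $\mathcal H$) with a tracial normal faithful state $\tau$. A (possibly unbounded) self-adjoint operator $X$ is affiliated with $\mathcal{M}$ if $f(X)\in\mathcal{M}$ for every bounded Borel function $f$ on $\mathbb{R}$; such operators are called random variables. The spectral distribution function of $X$ is $F_X(x)=\tau(\mathbb{1}_{(-\infty,x]}(X))$, $x\in\mathbb{R}$, where $\mathbb{1}_B$ is the indicator function of $B$. For projections $P,Q\in\mathcal{M}$, $P\lor Q$ is the projection onto the closure of $P\mathcal{H}+Q\mathcal{H}$. For self-adjoint $X,Y$ affiliated with $\mathcal{M}$, the spectral maximum $X\lor Y$ is the self-adjoint operator affiliated with $\mathcal{M}$ determined by $\mathbb{1}_{(x,\infty)}(X\lor Y)=\mathbb{1}_{(x,\infty)}(X)\lor\mathbb{1}_{(x,\infty)}(Y)$ for all $x\in\mathbb{R}$. For freely independent $X,Y$ one has $F_{X\lor Y}=\max\{F_X+F_Y-1,0\}$ (Ben Arous–Voiculescu); hence $F_{W_n}(x)=\max\{nU(a_nx+b_n)-(n-1),0\}$. ''$W_n$ has density $u_n$'' means $\tau(f(W_n))=\int_{\mathbb{R}}f(x)u_n(x)\,dx$ for all bounded Borel functions $f$; $\mathrm{supp}(u_n)=\overline{\{x:u_n(x)>0\}}$; $u_n(A_n+)=\lim_{t\to A_n+0}u_n(t)$; $a\wedge b=\min\{a,b\}$. Since $\rho_n$ is defined on $(A_n,B_n)$, where the distribution of $W_n$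 is concentrated, $\tau(|1+\gamma^{-1}(1+W_n\rho_n(W_n))|)=\int_{A_n}^{B_n}|1+\gamma^{-1}(1+x\rho_n(x))|u_n(x)\,dx$. The Kolmogorov distance between distribution functions $F_1,F_2$ on $\mathbb{R}$ is $d_K(F_1,F_2)=\sup_{x\in\mathbb{R}}|F_1(x)-F_2(x)|$. *)

(* Defs.v *)
From HB Require Import structures.
From mathcomp Require Import all_boot all_order all_algebra sesquilinear.
From mathcomp Require Import complex.
From mathcomp Require Import all_classical all_reals all_analysis.

Set Implicit Arguments.
Unset Strict Implicit.
Unset Printing Implicit Defensive.

Import Order.TTheory GRing.Theory Num.Theory numFieldNormedType.Exports.

Local Open Scope classical_set_scope.
Local Open Scope ring_scope.
Local Open Scope complex_scope.

(* The inner product is linear in its first argument. *)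
Record hilbertSpace (R : realType) := HilbertSpace {
  hilbert_sort :> completeNormedModType R[i] ;
  inner : {dot hilbert_sort for Num.conj} ;
  inner_norm : forall x, `|x| ^+ 2 = inner x x }.

Notation "<| x , y |>" := (inner _ x y)
  (at level 0, x at level 69, y at level 69, format "<| x ,  y |>") : ring_scope.

Section BoundedOperators.
Variables (R : realType) (H : hilbertSpace R).
Implicit Types (P Q S T : H -> H) (M : set (H -> H)).

Definition bounded_op T := linear T /\ continuous T.

Definition is_adjoint T T' := forall x y, <|T x, y|> = <|x, T' y|>.

Definition commutant M : set (H -> H) :=
  [set T | bounded_op T /\ forall S, M S -> T \o S = S \o T].

Definition von_neumann_algebra M :=
  [/\ M `<=` bounded_op,
      forall T, M T -> exists2 T', M T' & is_adjoint T T' &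
      commutant (commutant M) = M].

Definition is_projection P :=
  [/\ bounded_op P, P \o P = P & is_adjoint P P].

Definition is_proj_join P Q S :=
  is_projection S /\
  range S = closure [set x + y | x in range P & y in range Q].

Definition op_le S T := forall x, 0 <= <|T x - S x, x|>.

(* A nonempty upward directed family of positive elements of M having T as its
   supremum in M: an increasing net with supremum T. *)
Definition directed_to M (D : set (H -> H)) T :=
  [/\ D !=set0,
      forall S, D S -> M S /\ op_le (fun=> 0) S,
      forall S S', D S -> D S' -> exists S'', [/\ D S'', op_le S S'' & op_le S' S''],
      M T /\ (forall S, D S -> op_le S T) &
      forall T', M T' -> (forall S, D S -> op_le S T') -> op_le T T'].

(* tau is only constrained on M; its values elsewhere are irrelevant. *)
Record tracial_state M (tau : (H -> H) -> R[i]) := TracialState {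
  state_linear : forall c S T, M S -> M T ->
    tau (fun x => c *: S x + T x) = c * tau S + tau T ;
  state_unit : tau id = 1 ;
  state_pos : forall T T', M T -> is_adjoint T T' -> 0 <= tau (T' \o T) ;
  state_faithful : forall T T', M T -> is_adjoint T T' ->
    tau (T' \o T) = 0 -> T = fun=> 0 ;
  state_tracial : forall S T, M S -> M T -> tau (S \o T) = tau (T \o S) ;
  state_normal : forall D T, directed_to M D T ->
    complex.Re (tau T) = sup [set complex.Re (tau S) | S in D] }.

Definition tracial_Wstar_space M (tau : (H -> H) -> R[i]) :=
  von_neumann_algebra M /\ tracial_state M tau.

(* Free independence of the subalgebras (A i): alternating products of centred
   elements are centred. *)
Definition free_family (tau : (H -> H) -> R[i]) (I : Type)
    (A : I -> set (H -> H)) :=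
  forall (k : nat) (i : nat -> I) (T : nat -> H -> H), (0 < k)%N ->
    (forall j, (j < k)%N -> A (i j) (T j) /\ tau (T j) = 0) ->
    (forall j, (j.+1 < k)%N -> i j <> i j.+1) ->
    tau (\big[(fun S S' => S \o S')/id]_(0 <= j < k) T j) = 0.

End BoundedOperators.

Section UnboundedOperators.
Variables (R : realType) (H : hilbertSpace R).

(* A possibly unbounded operator is given by its graph. *)
Definition operator := set (H * H).
Implicit Types (X Y Z : operator).

Definition domain X : set H := [set x | exists y, X (x, y)].

(* The graph of X coincides with the graph of its adjoint. Density of the
   domain makes the adjoint single-valued, hence X is a linear operator. *)
Definition self_adjoint X :=
  dense (domain X) /\
  forall y z, X (y, z) <-> forall x w, X (x, w) -> <|w, y|> = <|x, z|>.

(* The operator (X - b) / a. *)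
Definition affine_op X (a b : R) : operator :=
  [set p | exists2 z, X (p.1, z) & p.2 = a^-1%:C *: (z - b%:C *: p.1)].

(* A projection-valued measure E on the Borel sets of the real line, bundled
   with the scalar measures E_x(B) = <E(B) x, x>, whose sigma-additivity is the
   strong sigma-additivity of E. *)
Record pvm := PVM {
  pvm_proj :> set R -> H -> H ;
  pvm_meas : H -> {measure set (measurableTypeR R) -> \bar R} ;
  pvm_projection : forall B : set (measurableTypeR R), measurable B ->
    is_projection (pvm_proj B) ;
  pvm_setT : pvm_proj setT = id ;
  pvm_setI : forall A B : set (measurableTypeR R), measurable A -> measurable B ->
    pvm_proj (A `&` B) = pvm_proj A \o pvm_proj B ;
  pvm_measE : forall x (B : set (measurableTypeR R)), measurable B ->
    pvm_meas x B = (complex.Re <|pvm_proj B x, x|>)%:E }.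

(* X is the integral of the identity function against dE. *)
Definition is_spectral_measure X (E : pvm) :=
  (forall x, domain X x <-> (\int[pvm_meas E x]_t (t ^+ 2)%:E < +oo)%E) /\
  (forall x y, X (x, y) -> <|y, x|> = (\int[pvm_meas E x]_t t)%R%:C).

Definition bounded_borel (f : R -> R) :=
  measurable_fun [set: R] f /\ exists c, forall t, `|f t| <= c.

(* T = f(X); on a complex Hilbert space the quadratic form determines T. *)
Definition is_fcalc X (f : R -> R) (T : H -> H) :=
  bounded_op T /\
  exists2 E, is_spectral_measure X E &
    forall x, <|T x, x|> = (\int[pvm_meas E x]_t f t)%R%:C.

(* f(X), for X self-adjoint and f bounded Borel; by the spectral theorem it is
   the unique T such that is_fcalc X f T. *)
Definition fcalc X (f : R -> R) : H -> H :=
  xget (fun=> 0) [set T | is_fcalc X f T].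

Definition affiliated (M : set (H -> H)) X :=
  forall f, bounded_borel f -> exists2 T, is_fcalc X f T & M T.

(* The von Neumann algebra generated by X: the f(X) with f real-valued are
   self-adjoint and span those with f complex-valued. *)
Definition Wstar X : set (H -> H) :=
  commutant (commutant [set fcalc X f | f in bounded_borel]).

Definition is_spectral_max (M : set (H -> H)) X Y Z :=
  [/\ self_adjoint Z, affiliated M Z &
      forall t : R, is_proj_join (fcalc X \1_(`]t, +oo[)) (fcalc Y \1_(`]t, +oo[))
                                 (fcalc Z \1_(`]t, +oo[))].

Definition spectral_cdf (tau : (H -> H) -> R[i]) X (t : R) : R :=
  complex.Re (tau (fcalc X \1_(`]-oo, t]))).

Definition has_density (tau : (H -> H) -> R[i]) X (u : R -> R) :=
  [/\ forall t, 0 <= u t,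
      lebesgue_measure.-integrable [set: R] (EFin \o u) &
      forall f, bounded_borel f ->
        tau (fcalc X f) = (\int[lebesgue_measure]_t (f t * u t))%R%:C].

End UnboundedOperators.

Section RealFunctions.
Variable R : realType.
Implicit Types (F G u : R -> R).

Definition Psi (gamma : R) : R -> R := fun x =>
  (1 - `|x| `^ (- gamma)) * \1_(`[-1, 0]) x + \1_(`]0, +oo[) x.

Definition weak_cvg (F : nat -> R -> R) G :=
  forall x, {for x, continuous G} -> F n x @[n --> \oo] --> G x.

Definition kolmogorov_dist F G : R := sup (range (fun x => `|F x - G x|)).

Definition supp u : set R := closure [set x | 0 < u x].

(* (log u)', meaningful on open sets where u is positive and differentiable. *)
Definition score u : R -> R := derive1 (@ln R \o u).

End RealFunctions.

(* Main.v *)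
Require Import Defs.
From HB Require Import structures.
From mathcomp Require Import all_boot all_order all_algebra sesquilinear.
From mathcomp Require Import complex.
From mathcomp Require Import all_classical all_reals all_analysis.
From mathcomp Require Import measurable_realfun ring lra.

Set Implicit Arguments.
Unset Strict Implicit.
Unset Printing Implicit Defensive.

Import Order.TTheory GRing.Theory Num.Theory numFieldNormedType.Exports.

Local Open Scope classical_set_scope.
Local Open Scope ring_scope.
Local Open Scope complex_scope.

(** Put [al = - gamma > 0] and let [F] be the distribution function of [W n], a
    primitive of its density [u]. On [-1, 0] the function [Psi gamma] is
    [1 - |x| ^ al], which solves the first order equation
    [F + gamma^-1 * x * F' = 1]. So the function [G = F + gamma^-1 * x * u] measures
    how far [F] is from being [Psi gamma]. Its derivative is
    [(1 + gamma^-1 * (1 + x * score u x)) * u x], so the trace in the theorem is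
    the total variation [T] of [G] on [(A, B)], while [G] goes from
    [g0 = gamma^-1 * A * u(A+)] at [A] to [1] at [B].

    Splitting the variation of [G] at a point gives constant bounds
    [1 - T <= G <= C] with [C = (1 + T + g0) / 2], and also [|1 - g0| <= T]
    ([dominated_range]). Since [|x| ^ (- al) * (F - C)] has a derivative of the same
    sign as [G - C], these bounds integrate to
    [(1 - T) * (1 - y) <= F x <= C * (1 - y)] where [y = |x / A| ^ al]
    ([flow_comparison]). What remains is an inequality between affine functions of
    [|x| ^ al], to be checked at the ends of its range ([envelope_Psi]); outside
    [[A, B]] the function [F] is constant and [Psi gamma] is monotone.

    The operators enter only through the density. It yields [F] as an integral and
    the trace as the integral of the discrepancy against [u]; that [u] has mass [1]
    follows from [1(W n)] being the identity operator, which is a polarization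
    argument ([is_fcalc_cst1], [density_integral1]). *)

(** * Total mass of a spectral density *)

Section SpectralDensity.
Variables (R : realType) (H : hilbertSpace R).

(** Complex polarization: replacing [x] by [x + y] makes the sesquilinear form of
    [S] skew, replacing [x] by ['i *: x] makes it symmetric. *)
Lemma quadratic_form_eq0 (S : H -> H) :
  linear S -> (forall x, <|S x, x|> = 0) -> S = fun=> 0.
Proof.
move=> linS S0.
have SD x y : S (x + y) = S x + S y by have := linS 1 x y; rewrite !scale1r.
have S00 : S 0 = 0 by apply: (addrI (S 0)); rewrite -SD !addr0.
have SZ c x : S (c *: x) = c *: S x by have := linS c x 0; rewrite S00 !addr0.
have skew x y : <|S x, y|> + <|S y, x|> = 0.
  have := S0 (x + y).
  by rewrite SD linearDl !linearDr /= !S0 add0r addr0.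
apply/funext => x.
have: <|S x, S x|> = 0.
  have sym y : <|S x, y|> = 0.
    have h1 := skew x y.
    have := skew ('i *: x) y.
    rewrite SZ linearZl_LR linearZr_LR /= => h2.
    have ii : ('i : R[i]) * 'i = -1 by rewrite -expr2 sqr_i.
    have cI : Num.conj ('i : R[i]) = - 'i by rewrite -[LHS]/(('i)^*)%C /=; simpc.
    move: h2; rewrite cI mulNr -mulrBr => /eqP.
    rewrite mulf_eq0 => /orP[/eqP i0|/eqP h2].
      by move: ii; rewrite i0 mul0r => /eqP; rewrite eq_sym oppr_eq0 oner_eq0.
    have : <|S x, y|> *+ 2 = 0.
      by rewrite mulr2n -[X in _ + X](subrK <|S y, x|>) h2 add0r h1.
    by move/eqP; rewrite mulrn_eq0 => /eqP.
  exact: sym.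
by rewrite -inner_norm => /eqP; rewrite expf_eq0/= normr_eq0 => /eqP.
Qed.

(** [fcalc] takes the value [0] when no operator satisfies [is_fcalc]; any other
    value comes from the calculus. *)
Lemma is_fcalc_neq0 (X : operator H) (f : R -> R) :
  fcalc X f <> (fun=> 0) -> is_fcalc X f (fcalc X f).
Proof.
move=> f0; rewrite /fcalc; case: xgetP => [T _ //|noT].
by exfalso; apply: f0; rewrite /fcalc xgetPN.
Qed.

(** The quadratic form of [1(X)] is the total mass of [pvm_meas E x], which is
    [<|x, x|>]. *)
Lemma is_fcalc_cst1 (X : operator H) T : is_fcalc X (cst 1) T -> T = id.
Proof.
move=> [[linT _] [E _ TE]].
have norm1 x : <|T x, x|> = <|x, x|>.
  rewrite TE Rintegral_cst// mul1r pvm_measE// pvm_setT/=.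
  rewrite -inner_norm.
  have : (`|x| ^+ 2) \is Num.real by rewrite realX.
  by move=> /RRe_real ->.
have : (fun x => T x - x) = fun=> 0.
  apply: quadratic_form_eq0.
    by move=> c x y; rewrite linT scalerBr opprD addrACA.
  by move=> x; rewrite linearBl/= norm1 subrr.
move=> TB0; apply/funext => x; apply/eqP.
by rewrite -subr_eq0; move/(congr1 (@^~ x)): TB0 => /= ->.
Qed.

Lemma trace0 (M : set (H -> H)) tau :
  tracial_Wstar_space M tau -> tau (fun=> 0) = 0.
Proof.
move=> [[_ _ MCC] ts].
have M0 : M (fun=> 0).
  rewrite -MCC; split; first split.
  - by move=> c x y /=; rewrite scaler0 addr0.
  - exact: cst_continuous.
  move=> S [[linS _] _]; apply/funext => x /=.
  have := linS 1 0 0; rewrite !scale1r addr0 => S00.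
  by apply: (addrI (S 0)); rewrite addr0 -S00.
have := state_linear ts 1 M0 M0.
rewrite mul1r (_ : (fun x => _) = fun=> 0); last first.
  by apply/funext => x; rewrite scaler0 addr0.
by move=> tauD; apply: (addrI (tau (fun=> 0))); rewrite addr0 -tauD.
Qed.

(** If the integral is nonzero, then [1(X)] cannot be the default value [0] of
    [fcalc]; so it is the identity, of trace [1]. *)
Lemma density_integral1 (M : set (H -> H)) tau (X : operator H) u :
  tracial_Wstar_space M tau -> has_density tau X u ->
  (\int[lebesgue_measure]_t u t)%R != 0 -> (\int[lebesgue_measure]_t u t)%R = 1.
Proof.
move=> Mt [_ _ Xu] u0.
have b1 : bounded_borel (cst 1 : R -> R).
  by split; [exact: measurable_cst|exists 1 => t; rewrite normr1].
have := Xu _ b1.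
under eq_Rintegral do rewrite mul1r.
move=> E.
have [f0|/eqP f0] := pselect (fcalc X (cst 1) = fun=> 0).
  by move: E u0; rewrite f0 (trace0 Mt) => -[<-]; rewrite eqxx.
have := is_fcalc_neq0 (elimN eqP f0).
move/is_fcalc_cst1 => id1; move: E; rewrite id1 (state_unit Mt.2) => -[<-]//.
Qed.

End SpectralDensity.

(** * Distribution functions as primitives *)

Section Primitives.
Variable R : realType.
Local Notation mu := (@lebesgue_measure R).
Implicit Type v : R -> R.

Definition primitive v (x : R) : R := (\int[mu]_(t in `]-oo, x]) v t)%R.

Lemma is_derive_primitive v x : mu.-integrable [set: R] (EFin \o v) ->
  {for x, continuous v} -> is_derive x 1 (primitive v) (v x).
Proof.
move=> iv cv.
have [] := @continuous_FTC1 R v -oo%O x (x + 1) _ _ _ cv => //.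
- by rewrite ltrDl.
- exact: integrableS iv.
- by rewrite ltNyr.
- by move=> dF F'; split => //; rewrite -derive1E.
Qed.

Lemma primitiveB v a x : mu.-integrable [set: R] (EFin \o v) -> a <= x ->
  primitive v x - primitive v a = (\int[mu]_(t in `[a, x]) v t)%R.
Proof.
move=> iv ax; rewrite /primitive Rintegral_itvB ?Rintegral_itv_obnd_cbnd//=.
- exact: integrableS iv.
- exact: integrableS iv.
Qed.

Lemma primitive_within_continuous v a b : mu.-integrable [set: R] (EFin \o v) ->
  a <= b -> {within `[a, b], continuous (primitive v)}.
Proof.
move=> iv ab.
have cI := @parameterized_integral_continuous R a b v ab _.
have {}cI := cI (integrableS _ _ _ iv).
have : {within `[a, b],
    continuous (fun x => primitive v a + parameterized_integral mu a x v)}.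
  by move=> x; apply: cvgD; [exact: cvg_cst|apply: cI].
apply: subspace_eq_continuous => x /=; rewrite inE/= in_itv/= => /andP[ax xb].
change (primitive v a + (\int[mu]_(t in `[a, x]) v t)%R = primitive v x).
by rewrite -(primitiveB iv ax) addrC subrK.
Qed.

Lemma primitive_ge0 v x : (forall t, 0 <= v t) -> 0 <= primitive v x.
Proof. by move=> v0; apply: Rintegral_ge0. Qed.

Lemma primitive_tail v x : mu.-integrable [set: R] (EFin \o v) ->
  (\int[mu]_t v t)%R - primitive v x = (\int[mu]_(t in `]x, +oo[) v t)%R.
Proof.
move=> iv; rewrite /primitive -(@Rintegral_itvB _ _ -oo%O +oo%O)//.
- by rewrite set_itvNyy.
- by rewrite set_itvNyy.
Qed.

Lemma primitive_le_total v x : mu.-integrable [set: R] (EFin \o v) ->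
  (forall t, 0 <= v t) -> primitive v x <= (\int[mu]_t v t)%R.
Proof.
by move=> iv v0; rewrite -subr_ge0 primitive_tail//; apply: Rintegral_ge0.
Qed.

Lemma Rintegral_eq0 v D : (forall t, D t -> v t = 0) ->
  (\int[mu]_(t in D) v t)%R = 0.
Proof.
by move=> v0; rewrite /Rintegral integral0_eq// => t /v0 ->.
Qed.

Lemma primitive_eq0 v x : mu.-integrable [set: R] (EFin \o v) ->
  (forall t, t < x -> v t = 0) -> primitive v x = 0.
Proof.
move=> iv v0; rewrite /primitive -Rintegral_itv_bndo_bndc.
  by apply: Rintegral_eq0 => t /=; rewrite in_itv/= => /v0.
exact: integrableS iv.
Qed.

Lemma primitive_eq_total v x : mu.-integrable [set: R] (EFin \o v) ->
  (forall t, x < t -> v t = 0) -> primitive v x = (\int[mu]_t v t)%R.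
Proof.
move=> iv v0; apply/esym/eqP; rewrite -subr_eq0 primitive_tail//.
by rewrite Rintegral_eq0// => t /=; rewrite in_itv/= andbT => /v0.
Qed.

End Primitives.

(** * A comparison principle for F + |x| F' / al *)

Section Comparison.
Variable R : realType.

Lemma within_continuous_le (f : R -> R) (a b : R) (c : R) : a < b ->
  {within `[a, b], continuous f} -> (forall x, a < x < b -> f x <= c) ->
  f b <= c.
Proof.
move=> ab /(continuous_within_itvP _ ab)[_ _ cf] fc.
rewrite -(cvg_lim (@Rhausdorff R) cf); apply: limr_le.
  exact: cvgP cf.
near=> x; apply: fc; apply/andP; split; near: x.
  exact: nbhs_left_gt.
exact: nbhs_left_lt.
Unshelve. all: by end_near. Qed.

Lemma is_derive_continuous (f : R -> R) (x df : R) :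
  is_derive x 1 f df -> {for x, continuous f}.
Proof.
by move=> [dfx _]; apply: differentiable_continuous; exact/derivable1_diffP.
Qed.

Lemma is_derive_powRN (al t : R) : t < 0 ->
  is_derive t 1 (fun s => (- s) `^ al) (- (al * (- t) `^ (al - 1))).
Proof.
move=> t0.
have h1 : is_derive t (1 : R) (fun s : R => - s) (- 1).
  by apply: is_deriveN.
have t0' : 0 < - t by rewrite oppr_gt0.
have h2 := @is_derive1_powR R al (- t) t0'.
have := @is_derive1_comp R (@powR R ^~ al) -%R t _ _ h2 h1.
by move/is_derive_eq; apply; rewrite mulrN1.
Qed.

(** The function may fail to be differentiable at [0], which is a possible right
    endpoint of the support; hence the separate treatment of the origin. *)
Lemma continuous_normr_powR (al : R) :
  0 < al -> continuous (fun x : R => `|x| `^ al).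
Proof.
move=> al0 x.
have [->|x0] := eqVneq x 0.
  rewrite /continuous_at normr0 powR0 ?gt_eqF//.
  apply/cvgrPdist_lt => e e0.
  near=> y; rewrite sub0r normrN ger0_norm ?powR_ge0//.
  have {1}-> : e = (e `^ al^-1) `^ al.
    by rewrite -powRrM mulVf ?gt_eqF// powRr1// ltW.
  rewrite gt0_ltr_powR ?nnegrE ?powR_ge0//.
  near: y; exists (e `^ al^-1); first exact: powR_gt0.
  by move=> z; rewrite /ball_/= sub0r normrN.
have nx : 0 < `|x| by rewrite normr_gt0.
apply: (@continuous_comp _ _ _ (fun x : R => `|x|) (@powR R ^~ al)).
  exact: norm_continuous.
apply: differentiable_continuous; apply/derivable1_diffP.
by have [] := @is_derive1_powR R al `|x| nx.
Unshelve. all: by end_near. Qed.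

(** For negative [t], the expression [F t - al^-1 * t * u t] is, up to the positive
    factor [al * |t| ^ (- al - 1)], the derivative of [|t| ^ (- al) * F t], and
    constants [C] behave in the same way. So a constant upper bound [C] of that
    expression makes [|t| ^ (- al) * (F t - C)] nonincreasing, and its value at [A]
    gives the bound. The weight is singular at [0], so the case [x = B] is obtained
    as a limit. Applied to [- F], the lemma bounds [F] from below. *)
Lemma flow_comparison (al A B C : R) (F u : R -> R) :
  0 < al -> A < B -> B <= 0 ->
  {within `[A, B], continuous F} -> F A = 0 ->
  (forall x, A < x < B -> is_derive x 1 F (u x)) ->
  (forall x, A < x < B -> F x - al^-1 * x * u x <= C) ->
  forall x, A <= x <= B -> F x <= C * (1 - `|x| `^ al / `|A| `^ al).
Proof.
move=> al0 AB B0 cF FA dF FC.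
have A0 : A < 0 by exact: lt_le_trans B0.
have Aal0 : 0 < `|A| `^ al by rewrite powR_gt0// normr_gt0 lt_eqF.
have interior x : A < x < B -> F x <= C * (1 - `|x| `^ al / `|A| `^ al).
  move=> /andP[Ax xB].
  have x0 : x < 0 by exact: lt_le_trans B0.
  pose phi t := (- t) `^ (- al) * (F t - C).
  have dphi t : A < t -> t < B ->
      is_derive t 1 phi (al * (- t) `^ (- al - 1) * (F t - al^-1 * t * u t - C)).
    move=> At tB; have t0 : t < 0 by exact: lt_le_trans B0.
    have h1 := is_derive_powRN (- al) t0.
    have h2 : is_derive t (1:R) F (u t) by apply: dF; rewrite At.
    have h3 : is_derive t (1:R) (fun t => F t - C) (u t - 0) by apply: is_deriveB.
    have h4 : is_derive t (1:R) phi ((- t) `^ (- al) *: (u t - 0) +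
        (F t - C) *: (- (- al * (- t) `^ (- al - 1)))).
      by apply: is_deriveM.
    move: h4 => /is_derive_eq; apply.
    rewrite /GRing.scale/= subr0.
    have -> : (- t) `^ (- al) = (- t) * (- t) `^ (- al - 1).
      rewrite -[X in X * _]powRr1 ?oppr_ge0 ?ltW//.
      rewrite -powRD ?oppr_eq0 ?(lt_eqF t0) ?implybT//.
      by congr (_ `^ _); ring.
    by field; rewrite gt_eqF.
  have : phi x <= phi A.
    apply: (@ler0_derive1_le_cc _ phi A x) => //=.
    - move=> t; rewrite in_itv/= => /andP[At tx].
      by have [] := dphi t At (lt_trans tx xB).
    - move=> t; rewrite in_itv/= => /andP[At tx].
      rewrite derive1E; have [_ ->] := dphi t At (lt_trans tx xB).
      apply: mulr_ge0_le0; first by rewrite mulr_ge0 ?powR_ge0// ltW.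
      by rewrite subr_le0 FC// At (lt_trans tx xB).
    - apply/(continuous_within_itvP _ Ax); split.
      + move=> t; rewrite in_itv/= => /andP[At tx].
        exact: is_derive_continuous (dphi t At (lt_trans tx xB)).
      + apply: cvgM; last first.
          apply: cvgB; last exact: cvg_cst.
          by have [_ ] := (continuous_within_itvP _ AB).1 cF.
        apply: cvg_at_right_filter.
        exact: is_derive_continuous (is_derive_powRN (- al) A0).
      + apply: cvg_at_left_filter.
        exact: is_derive_continuous (dphi x Ax xB).
    - by rewrite in_itv/= lexx ltW.
    - by rewrite in_itv/= lexx ltW.
    - exact: ltW.
  have p0 : 0 < `|x| `^ al by rewrite powR_gt0// normr_gt0 lt_eqF.
  rewrite /phi FA sub0r !powRN -!(ltr0_norm x0, ltr0_norm A0).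
  rewrite mulrC ler_pdivrMr// => h.
  rewrite -(lerD2r (- C)); apply: (le_trans h); rewrite le_eqVlt.
  apply/orP; left; apply/eqP.
  by field; rewrite !gt_eqF.
move=> x /andP[]; rewrite le_eqVlt => /predU1P[<- _|Ax].
  by rewrite FA divff ?gt_eqF// subrr mulr0.
rewrite le_eqVlt => /predU1P[->|xB]; last by rewrite interior ?Ax.
rewrite -subr_le0.
pose D x := F x - C * (1 - `|x| `^ al / `|A| `^ al).
apply: (@within_continuous_le D A B) => //.
  move=> y; apply: cvgB; first exact: cF.
  apply: cvgM; first exact: cvg_cst.
  apply: cvgB; first exact: cvg_cst.
  apply: cvgM; last exact: cvg_cst.
  have cn := continuous_normr_powR al0.
  exact: (continuous_subspaceT cn).
by move=> y yAB; rewrite subr_le0 interior.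
Qed.

End Comparison.

(** * Range of a function whose increments are dominated *)

Section DominatedIncrements.
Variable R : realType.

(** Both [I - G] and [I + G] are nondecreasing. *)
Lemma dominated_increment (G I h v : R -> R) (x y : R) : x <= y ->
  (forall t, x <= t <= y -> is_derive t 1 G (h t)) ->
  (forall t, x <= t <= y -> is_derive t 1 I (v t)) ->
  (forall t, x <= t <= y -> `|h t| <= v t) ->
  `|G y - G x| <= I y - I x.
Proof.
move=> xy dG dI hv.
have cont (f df : R -> R) : (forall t, x <= t <= y -> is_derive t 1 f (df t)) ->
    {within `[x, y], continuous f}.
  move=> dfP; apply: continuous_in_subspaceT => t; rewrite inE/= in_itv/= => xty.
  exact: is_derive_continuous (dfP t xty).
have mono (f df : R -> R) : (forall t, x <= t <= y -> is_derive t 1 f (df t)) ->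
    (forall t, x <= t <= y -> 0 <= df t) -> f x <= f y.
  move=> dfP df0; have cc t : t \in `]x, y[ -> x <= t <= y.
    by rewrite in_itv/= => /andP[/ltW -> /ltW ->].
  apply: (@ger0_derive1_le_cc _ f x y) => //.
  - by move=> t /cc /dfP [].
  - by move=> t /cc xty; rewrite derive1E; have [_ ->] := dfP t xty; exact: df0.
  - exact: cont dfP.
  - by rewrite in_itv/= lexx.
  - by rewrite in_itv/= lexx xy.
have h1 : I x - G x <= I y - G y.
  apply: (mono (fun t => I t - G t) (fun t => v t - h t)) => t xty.
    by have := dG t xty; have := dI t xty => ? ?; apply: is_deriveB.
  by rewrite subr_ge0 (le_trans (ler_norm _))// hv.
have h2 : I x + G x <= I y + G y.
  apply: (mono (fun t => I t + G t) (fun t => v t + h t)) => t xty.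
    by have := dG t xty; have := dI t xty => ? ?; apply: is_deriveD.
  by rewrite -[h t]opprK subr_ge0 (le_trans (ler_norm _))// normrN hv.
by rewrite ler_norml; apply/andP; split; lra.
Qed.

(** The variation of [G] from [A] to [x] is at most [I x], and from [x] to [B] at
    most [T - I x]. Averaging the two upper bounds [g0 + I x] and [g1 + T - I x] of
    [G x] eliminates [I x] and leaves a constant that is at most [g1 + T]. *)
Lemma dominated_range (G I h v : R -> R) (A B T g0 g1 : R) : A < B ->
  (forall t, A < t < B -> is_derive t 1 G (h t)) ->
  (forall t, A < t < B -> is_derive t 1 I (v t)) ->
  (forall t, A < t < B -> `|h t| <= v t) ->
  (forall t, 0 <= I t <= T) ->
  G t @[t --> A^'+] --> g0 -> G t @[t --> B^'-] --> g1 ->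
  `|g1 - g0| <= T /\
  forall x, A < x < B -> g1 - T <= G x <= (g0 + g1 + T) / 2.
Proof.
move=> AB dG dI hv IT G0 G1.
have incr x y : A < x -> x <= y -> y < B -> `|G y - G x| <= I y - I x.
  move=> Ax xy yB.
  have in_AB t : x <= t <= y -> A < t < B.
    by move=> /andP[xt ty]; rewrite (lt_le_trans Ax xt) (le_lt_trans ty yB).
  by apply: dominated_increment => // t /in_AB; [exact: dG|exact: dI|exact: hv].
have left x : A < x < B -> `|G x - g0| <= I x.
  move=> /andP[Ax xB].
  have cG : (fun t => `|G x - G t|) @ A^'+ --> `|G x - g0|.
    by apply: cvg_norm; apply: cvgB => //; exact: cvg_cst.
  rewrite -(cvg_lim (@Rhausdorff R) cG); apply: limr_le; first exact: cvgP cG.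
  near=> t; have /andP[It _] := IT t.
  apply: (le_trans (incr t x _ _ xB)); last by rewrite lerBlDr lerDl.
    by near: t; exact: nbhs_right_gt.
  by near: t; exact: nbhs_right_le.
have right x : A < x < B -> `|g1 - G x| <= T - I x.
  move=> /andP[Ax xB].
  have cG : (fun t => `|G t - G x|) @ B^'- --> `|g1 - G x|.
    by apply: cvg_norm; apply: cvgB => //; exact: cvg_cst.
  rewrite -(cvg_lim (@Rhausdorff R) cG); apply: limr_le; first exact: cvgP cG.
  near=> t; have /andP[_ It] := IT t.
  apply: (le_trans (incr x t Ax _ _)); last by rewrite lerB.
    by near: t; exact: nbhs_left_ge.
  by near: t; exact: nbhs_left_lt.
split; last first.
  move=> x xAB; have := left _ xAB; have := right _ xAB.
  rewrite !ler_norml => /andP[? ?] /andP[? ?].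
  have /andP[_ ?] := IT x; have /andP[? _] := IT x.
  by apply/andP; split; lra.
have mAB : A < (A + B) / 2 < B by apply/andP; split; lra.
have := left _ mAB; have := right _ mAB.
rewrite !ler_norml => /andP[? ?] /andP[? ?].
by apply/andP; split; lra.
Unshelve. all: by end_near. Qed.

End DominatedIncrements.

(** * From envelopes to the distance to Psi *)

Section Envelope.
Variable R : realType.

(** The case [1 <= |A|], with [z = |x| ^ al] and [r = |A| ^ (- al)]. For [z <= 1] both
    sides are affine in [z], so it suffices to look at [z = 0] and [z = 1]. For the
    upper envelope the gap at [z = 0] is [T + (1 - r) * g - (T + g - 1) / 2], which is
    nonnegative as [g - 1 <= T], and the gap at [z = 1] is at least
    [(1 - r) * (T + g - 1) / 2]. For [1 <= z] the upper envelope decreases in [z]. *)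
Lemma envelope_algebra_ge1 (T g r z f : R) : 0 <= g -> 0 < r <= 1 -> 0 <= z ->
  z * r <= 1 -> `|1 - g| <= T ->
  (1 - T) * (1 - z * r) <= f <= (1 + T + g) / 2 * (1 - z * r) ->
  (z <= 1 -> `|f - (1 - z)| <= T + (1 - r) * g) /\
  (1 <= z -> 0 <= f -> `|f| <= T + (1 - r) * g).
Proof.
rewrite !ler_norml => g0 /andP[r0 r1] z0 zr1 /andP[h1 h2] /andP[lo hi].
have T0 : 0 <= T by lra.
have e0 : 0 <= (1 - r) * g by rewrite mulr_ge0// subr_ge0.
have e1 : 0 <= (1 - r) * T by rewrite mulr_ge0// subr_ge0.
have e2 : 0 <= (1 - r) * (T + g - 1) by rewrite mulr_ge0//; lra.
have e3 : 0 <= r * T by rewrite mulr_ge0// ltW.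
have e4 : 0 <= z * r by rewrite mulr_ge0// ltW.
split.
  move=> z1; have z1' : 0 <= 1 - z by rewrite subr_ge0.
  apply/andP; split.
    have := mulr_ge0 z1' T0; have := mulr_ge0 z0 e0; have := mulr_ge0 z1' e0.
    have := mulr_ge0 z0 e1; have := mulr_ge0 z0 e3.
    nra.
  have := mulr_ge0 z1' e0; have := mulr_ge0 z0 e0; have := mulr_ge0 z0 e3.
  have := mulr_ge0 z0 e2.
  have : 0 <= (1 - z) * (1 + T - g) by rewrite mulr_ge0//; lra.
  nra.
move=> z1 f0; apply/andP; split; first lra.
apply: (le_trans hi).
have : 0 <= (z - 1) * r * (1 + T + g).
  by rewrite !mulr_ge0 ?subr_ge0// ?(ltW r0)//; lra.
nra.
Qed.

(** The case [|A| <= 1], with [s = |A| ^ al] and [y = |x / A| ^ al]. Both sides are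
    affine in [y]; at [y = 1], where [f = 0], the inequality follows from
    [1 <= T + g] multiplied by [1 - s]. *)
Lemma envelope_algebra_le1 (T g s y f : R) : 0 <= g -> 0 < s <= 1 -> 0 <= y <= 1 ->
  `|1 - g| <= T ->
  (1 - T) * (1 - y) <= f <= (1 + T + g) / 2 * (1 - y) ->
  `|f - (1 - s * y)| <= T + (1 - s) * g.
Proof.
rewrite !ler_norml => g0 /andP[s0 s1] /andP[y0 y1] /andP[h1 h2] /andP[lo hi].
have T0 : 0 <= T by lra.
have y1' : 0 <= 1 - y by rewrite subr_ge0.
have s1' : 0 <= 1 - s by rewrite subr_ge0.
have e0 := mulr_ge0 s1' g0.
have e2 : 0 <= (1 - s) * (T + g - 1) by rewrite mulr_ge0//; lra.
have e3 : 0 <= s * T by rewrite mulr_ge0// ltW.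
have := mulr_ge0 y0 e2; have := mulr_ge0 y1' e0; have := mulr_ge0 y0 e0.
have := mulr_ge0 y0 e3.
have : 0 <= (1 - y) * (1 + T - g) by rewrite mulr_ge0//; lra.
have := mulr_ge0 y0 s1'; have := mulr_ge0 y0 T0.
by move=> *; apply/andP; split; nra.
Qed.

Lemma Psi_lt (gamma x : R) : x < -1 -> Psi gamma x = 0.
Proof.
move=> x1; rewrite /Psi !indicE !memNset/= ?in_itv/= ?mulr0 ?addr0//.
  by apply/negP; rewrite andbT -leNgt; lra.
by apply/negP; rewrite negb_and -ltNge x1.
Qed.

Lemma Psi_mid (gamma x : R) :
  -1 <= x <= 0 -> Psi gamma x = 1 - `|x| `^ (- gamma).
Proof.
move=> x1; rewrite /Psi !indicE mem_set/= ?in_itv//= memNset/= ?mulr1 ?addr0//.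
by rewrite in_itv/= andbT; apply/negP; rewrite -leNgt; case/andP: x1.
Qed.

Lemma Psi_gt (gamma x : R) : 0 < x -> Psi gamma x = 1.
Proof.
move=> x0; rewrite /Psi !indicE memNset/= ?mem_set/= ?in_itv/= ?andbT//.
  by rewrite mulr0 add0r.
by apply/negP; rewrite negb_and -!ltNge x0 orbT.
Qed.

Lemma one_powR (al : R) : 1 `^ al = 1. Proof. by rewrite powR1. Qed.

Lemma normr_powR_le1 (al x : R) : 0 < al -> `|x| <= 1 -> `|x| `^ al <= 1.
Proof.
by move=> al0 x1; rewrite -[leRHS](one_powR al) ge0_ler_powR ?nnegrE// ltW.
Qed.

Lemma Psi_bounds (gamma x : R) : gamma < 0 -> 0 <= Psi gamma x <= 1.
Proof.
move=> g0; have al0 : 0 < - gamma by rewrite oppr_gt0.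
have [x1|x1] := ltP x (-1); first by rewrite Psi_lt// lexx ler01.
have [x0|x0] := leP x 0; last by rewrite Psi_gt// lexx ler01.
rewrite Psi_mid ?x1// subr_ge0 normr_powR_le1//= ?lerBlDr ?lerDl ?powR_ge0//.
by rewrite ler_norml x1 (le_trans x0).
Qed.

Lemma Psi_ndecr (gamma x y : R) :
  gamma < 0 -> x <= y -> Psi gamma x <= Psi gamma y.
Proof.
move=> g0 xy; have al0 : 0 < - gamma by rewrite oppr_gt0.
have [x1|x1] := ltP x (-1).
  by rewrite Psi_lt//; have /andP[] := Psi_bounds y g0.
have [y0|y0] := leP y 0; last first.
  by rewrite (Psi_gt _ y0); have /andP[] := Psi_bounds x g0.
rewrite !Psi_mid ?x1 ?y0 ?(le_trans xy)// ?(le_trans x1)// lerB//.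
rewrite ge0_ler_powR ?nnegrE// ?(ltW al0)//.
by rewrite !ler0_norm// ?(le_trans xy)// lerN2.
Qed.

(** The minimum in the bound merges the two cases [1 <= |A|] and [|A| < 1]: in the
    first one [Psi A = 0], in the second one [Psi A > 0] although the envelopes
    vanish at [A]. *)
Lemma envelope_Psi (gamma A x T g f : R) : gamma < 0 -> A < 0 -> A <= x <= 0 ->
  0 <= g -> `|1 - g| <= T -> 0 <= f ->
  (1 - T) * (1 - `|x| `^ (- gamma) / `|A| `^ (- gamma)) <= f
    <= (1 + T + g) / 2 * (1 - `|x| `^ (- gamma) / `|A| `^ (- gamma)) ->
  `|f - Psi gamma x| <= T + (1 - Num.min `|A| `|A|^-1 `^ (- gamma)) * g.
Proof.
move=> gamma0 A0 /andP[Ax x0] g0 gT f0.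
set al := - gamma; have al0 : 0 < al by rewrite oppr_gt0.
have nA : 0 < `|A| by rewrite normr_gt0 lt_eqF.
have a0 : 0 < `|A| `^ al by exact: powR_gt0.
have z0 : 0 <= `|x| `^ al by exact: powR_ge0.
have xA : `|x| `^ al <= `|A| `^ al.
  by rewrite ge0_ler_powR ?nnegrE// ?(ltW al0)// !ler0_norm ?(ltW A0)// lerN2.
have y1 : `|x| `^ al / `|A| `^ al <= 1 by rewrite ler_pdivrMr// mul1r.
have [A1|A1] := leP 1 `|A|.
  have Ai : `|A|^-1 <= 1 by rewrite invf_le1.
  rewrite min_r; last exact: le_trans A1.
  have r1 : 0 < (`|A|^-1) `^ al <= 1.
    rewrite powR_gt0 ?invr_gt0//=.
    have := @normr_powR_le1 al `|A|^-1 al0.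
    by rewrite ger0_norm ?invr_ge0//; apply.
  have rE : (`|A| `^ al)^-1 = (`|A|^-1) `^ al.
    by rewrite -powRN -[in RHS]powR_inv1// -powRrM mulN1r.
  rewrite rE => fb.
  have zr1 : `|x| `^ al * (`|A|^-1) `^ al <= 1 by rewrite -rE.
  have [h1 h2] := envelope_algebra_ge1 g0 r1 z0 zr1 gT fb.
  have [x1|x1] := ltP x (-1).
    rewrite Psi_lt// subr0 h2//.
    rewrite -[leLHS](one_powR al) ge0_ler_powR ?nnegrE ?(ltW al0)//.
    by rewrite ler0_norm//; lra.
  rewrite Psi_mid ?x1// h1// normr_powR_le1//.
  by rewrite ler0_norm//; lra.
have Ai : 1 <= `|A|^-1 by rewrite invf_ge1// ltW.
rewrite min_l; last by rewrite (le_trans (ltW A1)).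
have s1 : 0 < `|A| `^ al <= 1 by rewrite a0/= normr_powR_le1// ltW.
move=> fb; rewrite Psi_mid; last first.
  by rewrite x0 andbT; move: A1; rewrite ltr0_norm//; lra.
have -> : `|x| `^ (- gamma) = `|A| `^ al * (`|x| `^ al / `|A| `^ al).
  by rewrite mulrC divfK ?gt_eqF.
apply: envelope_algebra_le1 => //.
by rewrite y1 divr_ge0// ltW.
Qed.

End Envelope.

(** * The distance bound for a differentiable distribution function *)

Section Distance.
Variable R : realType.

(** The function [G = F + gamma^-1 * t * u] would be the constant [1] on [(-1, 0)] if
    [F] were [Psi gamma]. Its variation is controlled by [I], so [dominated_range]
    gives it constant bounds, [flow_comparison] turns them into an envelope of [F],
    and [envelope_Psi] concludes on the support. Outside the support [F] is constant,
    and monotonicity of [Psi] reduces the claim to the endpoints. *)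
Lemma distance_bound (gamma A B T g0 : R) (F u I h v : R -> R) :
  gamma < 0 -> A < B -> B <= 0 -> 0 <= g0 ->
  {within `[A, B], continuous F} ->
  (forall x, 0 <= F x <= 1) ->
  (forall x, x <= A -> F x = 0) -> (forall x, B <= x -> F x = 1) ->
  (forall x, A < x < B -> is_derive x 1 F (u x)) ->
  (forall x, A < x < B ->
    is_derive x 1 (fun t => F t + gamma^-1 * t * u t) (h x)) ->
  (forall x, A < x < B -> is_derive x 1 I (v x)) ->
  (forall x, A < x < B -> `|h x| <= v x) ->
  (forall x, 0 <= I x <= T) ->
  F t + gamma^-1 * t * u t @[t --> A^'+] --> g0 ->
  F t + gamma^-1 * t * u t @[t --> B^'-] --> (1 : R) ->
  forall x, `|F x - Psi gamma x|
    <= T + (1 - Num.min `|A| `|A|^-1 `^ (- gamma)) * g0.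
Proof.
move=> gamma0 AB B0 g0ge0 cF F01 FA FB dF dG dI hv IT GA GB.
have A0 : A < 0 by exact: lt_le_trans B0.
have al0 : 0 < - gamma by rewrite oppr_gt0.
have alV : (- gamma)^-1 = - gamma^-1 by rewrite invrN.
have [g01 Grange] := dominated_range AB dG dI hv IT GA GB.
have hi := @flow_comparison R (- gamma) A B ((1 + T + g0) / 2) F u al0 AB B0 cF
  (FA A (lexx A)) dF.
have lo := @flow_comparison R (- gamma) A B (- (1 - T))
  (fun x => - F x) (fun x => - u x) al0 AB B0.
have inAB x : A <= x <= B -> `|F x - Psi gamma x|
    <= T + (1 - Num.min `|A| `|A|^-1 `^ (- gamma)) * g0.
  move=> /andP[Ax xB]; have /andP[Fx0 Fx1] := F01 x.
  apply: envelope_Psi => //; first by rewrite Ax (le_trans xB).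
  apply/andP; split; last first.
    apply: hi; last by rewrite Ax.
    move=> y yAB; have /andP[_] := Grange y yAB.
    rewrite alV !mulNr opprK.
    by rewrite (addrC g0) addrAC.
  rewrite -lerN2 -mulNr; apply: lo => //.
  - by move=> y; apply: cvgN; exact: cF.
  - by rewrite FA// oppr0.
  - by move=> y yAB; have := dF y yAB => ?; apply: is_deriveN.
  - move=> y yAB; have /andP[+ _] := Grange y yAB.
    by rewrite alV !mulNr mulrN opprK -opprD lerN2.
  - by rewrite Ax.
move=> x; have [xA|Ax] := ltP x A.
  have := inAB A; rewrite lexx ltW//= => /(_ isT); apply: le_trans.
  rewrite (FA x (ltW xA)) FA// !sub0r !normrN.
  have /andP[? _] := Psi_bounds x gamma0; have /andP[? _] := Psi_bounds A gamma0.
  by rewrite !ger0_norm// Psi_ndecr// ltW.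
have [xB|Bx] := leP x B; first by rewrite inAB// Ax.
have := inAB B; rewrite lexx ltW//= => /(_ isT); apply: le_trans.
have /andP[_ ?] := Psi_bounds x gamma0; have /andP[_ ?] := Psi_bounds B gamma0.
by rewrite (FB x (ltW Bx)) FB// !ger0_norm ?subr_ge0// lerB// Psi_ndecr// ltW.
Qed.

End Distance.

(** * Distribution function and discrepancy of a density *)

Section Discrepancy.
Variable R : realType.
Local Notation mu := (@lebesgue_measure R).

Lemma spectral_cdf_density (H : hilbertSpace R) (tau : (H -> H) -> R[i])
    (X : operator H) u : has_density tau X u ->
  spectral_cdf tau X = primitive u.
Proof.
move=> [_ _ Xu]; apply/funext => x; rewrite /spectral_cdf Xu/=.
  rewrite /primitive [RHS]Rintegral_mkcond; apply: eq_Rintegral => t _.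
  by rewrite patchE indicE; case: ifPn => _; rewrite ?mul1r ?mul0r.
split; first exact: measurable_indic.
by exists 1 => t; rewrite indicE; case: (_ \in _); rewrite ?normr1 ?normr0.
Qed.

Lemma score_derive (u : R -> R) (t : R) : 0 < u t -> derivable u t 1 ->
  derive1 u t = score u t * u t.
Proof.
move=> ut du; have dln := is_derive1_ln ut.
rewrite /score (@derive1_comp _ u (@ln R))//.
rewrite !derive1E; have [_ ->] := dln.
by rewrite mulrAC mulVf ?mul1r ?gt_eqF.
Qed.

Lemma integrable_bounded_mul (k u : R -> R) : bounded_borel k ->
  mu.-integrable [set: R] (EFin \o u) ->
  mu.-integrable [set: R] (EFin \o (fun t => k t * u t)).
Proof.
move=> [mk [c kc]] iu; have mu_ := measurable_int _ iu.
apply: (@le_integrable _ _ _ mu _ _ _ (fun t => c%:E * (u t)%:E)%E) => //.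
- apply/measurable_EFinP; apply: measurable_funM => //.
  exact/measurable_EFinP.
- move=> t _ /=; rewrite lee_fin !normrM ler_wpM2r//.
  by rewrite (le_trans (kc t))// ler_norm.
- exact: (integrableZl _ _ iu).
Qed.

Lemma bounded_borel_itv (A B c : R) (f : R -> R) :
  {in `]A, B[, continuous f} -> (forall t, t \in `]A, B[ -> `|f t| <= c) ->
  bounded_borel (fun t => `|f t| * \1_(`]A, B[) t).
Proof.
move=> cf fc; split; last first.
  exists `|c| => t; rewrite indicE; have [|_] := boolP (t \in _).
    by rewrite inE/= => /fc h; rewrite mulr1 normr_id (le_trans h)// ler_norm.
  by rewrite mulr0 normr0.
rewrite (_ : (fun t => _) = (fun t => `|f t|) \_ `]A, B[); last first.
  apply/funext => t; rewrite patchE indicE.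
  by case: ifPn => _; rewrite ?mulr1 ?mulr0.
have mAB : measurable (`]A, B[ : set R) by exact: measurable_itv.
apply: (iffLR (measurable_restrictT (fun t => `|f t|) mAB)).
apply: measurableT_comp => //.
apply: open_continuous_measurable_fun; first exact: interval_open.
by move=> t; rewrite inE/= => /cf.
Qed.

(** If [F] is a primitive of [u], then [F + gamma^-1 * t * u] has the derivative
    [discrepancy gamma u * u] where [u] is positive and differentiable. *)
Definition discrepancy (gamma : R) (u : R -> R) (t : R) : R :=
  1 + gamma^-1 * (1 + t * score u t).

Lemma discrepancy_continuous (gamma A B : R) (u : R -> R) :
  {in `]A, B[, continuous (fun t : R => t * score u t)} ->
  {in `]A, B[, continuous (discrepancy gamma u)}.
Proof.
move=> cs t tAB; apply: cvgD; first exact: cvg_cst.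
apply: cvgM; first exact: cvg_cst.
by apply: cvgD; [exact: cvg_cst|exact: cs].
Qed.

Lemma bounded_borel_discrepancy (gamma A B c : R) (u : R -> R) :
  (forall t, t \in `]A, B[ -> `|t * score u t| <= c) ->
  {in `]A, B[, continuous (fun t : R => t * score u t)} ->
  bounded_borel (fun t => `|discrepancy gamma u t| * \1_(`]A, B[) t).
Proof.
move=> sc cs.
apply: (@bounded_borel_itv _ _ (1 + `|gamma^-1| * (1 + c))) => [|t tAB].
  exact: discrepancy_continuous.
rewrite (le_trans (ler_normD _ _))// normr1 lerD2l normrM.
rewrite ler_wpM2l// (le_trans (ler_normD _ _))// normr1 lerD2l.
exact: sc.
Qed.

End Discrepancy.

(** * The distance bound for a density *)

Section DensityBound.
Variable R : realType.
Local Notation mu := (@lebesgue_measure R).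

(** If the integral vanished, the primitive of [u] would be [0], and so would its
    derivative [u x]. *)
Lemma Rintegral_neq0 (u : R -> R) (x : R) : (forall t, 0 <= u t) ->
  mu.-integrable [set: R] (EFin \o u) -> {for x, continuous u} -> 0 < u x ->
  (\int[mu]_t u t)%R != 0.
Proof.
move=> u0 iu cu ux; apply/eqP => tot0.
have p0 : primitive u = cst 0.
  apply/funext => y; apply/eqP; rewrite eq_le primitive_ge0// andbT -tot0.
  exact: primitive_le_total.
have [_] := is_derive_primitive iu cu.
by rewrite p0 derive_cst => /eqP; rewrite lt_eqF.
Qed.

Lemma supp_eq0 (u : R -> R) (A B t : R) : (forall t, 0 <= u t) ->
  supp u = [set` `[A, B]] -> ~~ (A <= t <= B) -> u t = 0.
Proof.
move=> u0 su tAB; apply/eqP; rewrite eq_le u0 andbT leNgt; apply/negP => ut.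
have : supp u t by apply: subset_closure.
by rewrite su /= in_itv/= (negbTE tAB).
Qed.

(** [distance_bound] applies with [F] the primitive of [u] and [I] the primitive of
    [|discrepancy gamma u| * u]. As [t] is negative on the support, the limit of
    [F + gamma^-1 * t * u] at [A] is [- gamma^-1 * l]. *)
Lemma density_distance_bound (gamma A B l c : R) (u : R -> R) :
  gamma < 0 -> A < B -> B <= 0 -> 0 <= l ->
  (forall t, 0 <= u t) -> mu.-integrable [set: R] (EFin \o u) ->
  (\int[mu]_t u t)%R = 1 -> supp u = [set` `[A, B]] ->
  `|t| * u t @[t --> A^'+] --> l -> t * u t @[t --> B^'-] --> (0 : R) ->
  (forall t, t \in `]A, B[ -> 0 < u t /\ derivable u t 1) ->
  (forall t, t \in `]A, B[ -> `|t * score u t| <= c) ->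
  {in `]A, B[, continuous (fun t : R => t * score u t)} ->
  forall x, `|primitive u x - Psi gamma x| <=
    (\int[mu]_t (`|discrepancy gamma u t| * \1_(`]A, B[) t * u t))%R
    + (1 - Num.min `|A| `|A|^-1 `^ (- gamma)) * (- gamma^-1 * l).
Proof.
move=> gamma0 AB B0 l0 u0 iu u1 su uA uB ud sc cs.
set k := discrepancy gamma u.
set w := fun t => `|k t| * \1_(`]A, B[) t.
have itv t : A < t < B -> t \in `]A, B[ by rewrite in_itv.
have ck : {in `]A, B[, continuous k} by exact: discrepancy_continuous.
have iw : mu.-integrable [set: R] (EFin \o (fun t => w t * u t)).
  exact: integrable_bounded_mul (bounded_borel_discrepancy gamma sc cs) iu.
have w0 t : 0 <= w t * u t.
  by rewrite !mulr_ge0// indicE; case: (_ \in _).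
have cu t : A < t < B -> {for t, continuous u}.
  move=> /itv /ud[_ dut].
  by apply: differentiable_continuous; exact/derivable1_diffP.
have cw t : A < t < B -> {for t, continuous (fun t => w t * u t)}.
  move=> tAB; apply: cvgM; last exact: cu.
  have wt : w t = `|k t| by rewrite /w indicE mem_set ?mulr1//; exact: itv.
  rewrite wt.
  have ckt : `|k s| @[s --> t] --> `|k t|.
    by apply: cvg_norm; exact: ck (itv _ tAB).
  apply: cvg_trans ckt.
  apply: near_eq_cvg; near=> s.
  rewrite /w indicE mem_set/= ?mulr1//.
  by near: s; exact: near_in_itvoo (itv _ tAB).
have A0 : A < 0 by exact: lt_le_trans B0.
have dF t : A < t < B -> is_derive t 1 (primitive u) (u t).
  by move=> tAB; apply: is_derive_primitive => //; exact: cu.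
have cF : {within `[A, B], continuous (primitive u)}.
  by apply: primitive_within_continuous => //; exact: ltW.
have FA x : x <= A -> primitive u x = 0.
  move=> xA; apply: primitive_eq0 => // t tx; apply: (supp_eq0 u0 su).
  by rewrite negb_and -!ltNge (lt_le_trans tx xA).
have FB x : B <= x -> primitive u x = 1.
  move=> xB; rewrite primitive_eq_total// => t tx; apply: (supp_eq0 u0 su).
  by rewrite negb_and -!ltNge (le_lt_trans xB tx) orbT.
have [_ FA' FB'] := (continuous_within_itvP _ AB).1 cF.
apply: (@distance_bound R gamma A B _ _ (primitive u) u
    (primitive (fun t => w t * u t)) (fun t => k t * u t)
    (fun t => w t * u t)) => //.
- by rewrite mulr_ge0// oppr_ge0 invr_le0 ltW.
- by move=> x; rewrite primitive_ge0// -u1 primitive_le_total.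
- move=> t tAB; have [ut dut] := ud t (itv t tAB).
  have d1 := dF t tAB.
  have d2 : is_derive t (1 : R) u (score u t * u t).
    by split => //; rewrite -derive1E score_derive.
  have d3 : is_derive t (1 : R) (fun t => gamma^-1 * t) gamma^-1.
    by apply: is_derive_eq; rewrite /GRing.scale/= mulr1.
  have d4 := is_deriveD d1 (is_deriveM d3 d2).
  move: d4 => /is_derive_eq; apply.
  by rewrite /k /discrepancy /GRing.scale/=; ring.
- by move=> t tAB; apply: is_derive_primitive => //; exact: cw.
- by move=> t tAB; rewrite normrM (ger0_norm (u0 t)) /w indicE mem_set ?mulr1.
- by move=> x; rewrite primitive_ge0// primitive_le_total.
- rewrite (_ : - gamma^-1 * l = 0 + gamma^-1 * - l); last by rewrite add0r mulrN mulNr.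
  apply: cvgD; first by rewrite -(FA A).
  under eq_cvg do rewrite -mulrA.
  apply: cvgM; first exact: cvg_cst.
  apply: (@cvg_trans _ (- (`|t| * u t) @[t --> A^'+])); last exact: cvgN.
  apply: near_eq_cvg; near=> t.
  have t0 : t < 0 by apply: (lt_le_trans _ B0); near: t; exact: nbhs_right_lt.
  by rewrite (ltr0_norm t0) mulNr opprK.
- rewrite (_ : 1 = 1 + gamma^-1 * 0); last by rewrite mulr0 addr0.
  apply: cvgD; first by rewrite -(FB B).
  under eq_cvg do rewrite -mulrA.
  by apply: cvgM; [exact: cvg_cst|exact: uB].
Unshelve. all: by end_near. Qed.

Lemma cvg_right_divl (A l : R) (u : R -> R) : A < 0 ->
  `|t| * u t @[t --> A^'+] --> l -> u t @[t --> A^'+] --> l / `|A|.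
Proof.
move=> A0 uA; rewrite mulrC.
apply: (@cvg_trans _ (`|t|^-1 * (`|t| * u t) @[t --> A^'+])).
  apply: near_eq_cvg; near=> t.
  have t0 : t < 0 by near: t; exact: nbhs_right_lt.
  by rewrite mulKf// normr_eq0 lt_eqF.
apply: cvgM => //; apply: cvgV; first by rewrite normr_eq0 lt_eqF.
by apply: cvg_norm; apply: cvg_at_right_filter; exact: cvg_id.
Unshelve. all: by end_near. Qed.

End DensityBound.

Theorem theorem5p2 (R : realType) (H : hilbertSpace R)
    (M : set (H -> H)) (tau : (H -> H) -> R[i]) (gamma : R)
    (X maxX W : nat -> operator H) (U : R -> R) (a b : nat -> R)
    (u : nat -> R -> R) (A B : nat -> R) :
  gamma < 0 ->
  tracial_Wstar_space M tau ->
  (forall i, (1 <= i)%N ->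
    [/\ self_adjoint (X i), affiliated M (X i) & spectral_cdf tau (X i) = U]) ->
  free_family tau (fun i : nat => Wstar (X i.+1)) ->
  (* maxX n is the spectral maximum of X_1, ..., X_n *)
  maxX 1%N = X 1%N ->
  (forall n, (1 <= n)%N -> is_spectral_max M (maxX n) (X n.+1) (maxX n.+1)) ->
  (forall n, (1 <= n)%N -> 0 < a n) ->
  (forall n, (1 <= n)%N -> W n = affine_op (maxX n) (a n) (b n)) ->
  weak_cvg (fun n => spectral_cdf tau (W n)) (Psi gamma) ->
  (forall n, (2 <= n)%N ->
    [/\ has_density tau (W n) (u n),
        [/\ A n < B n, B n <= 0 & supp (u n) = [set` `[A n, B n]]],
        (exists2 l : R, 0 <= l & `|t| * u n t @[t --> (A n)^'+] --> l) /\
          t * u n t @[t --> (B n)^'-] --> 0,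
        (* positivity: log (u n) has to make sense on this interval *)
        (forall t, t \in `]A n, B n[ -> 0 < u n t /\ derivable (u n) t 1) &
        (exists c : R, forall t, t \in `]A n, B n[ -> `|t * score (u n) t| <= c) /\
          {in `]A n, B n[, continuous (fun t : R => t * score (u n) t)}]) ->
  forall n, (2 <= n)%N ->
    kolmogorov_dist (spectral_cdf tau (W n)) (Psi gamma) <=
      complex.Re (tau (fcalc (W n) (fun x =>
        `|1 + gamma^-1 * (1 + x * score (u n) x)| * \1_(`]A n, B n[) x)))
      + gamma^-1 * A n
        * (1 - (Num.min `|A n| (`|A n|^-1)) `^ (- gamma))
        * lim (u n t @[t --> (A n)^'+]).
Proof.
move=> gamma0 Mt _ _ _ _ _ _ _ hW n n2.
have [dens [AB B0 su] [[l l0 uA] uB] ud [[c sc] cs]] := hW n n2.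
have [u0 iu Wu] := dens.
have A0 : A n < 0 by exact: lt_le_trans B0.
have u1 : (\int[lebesgue_measure]_t u n t)%R = 1.
  apply: (density_integral1 Mt dens).
  have mAB : (A n + B n) / 2 \in `]A n, B n[.
    by rewrite in_itv/=; apply/andP; split; lra.
  have [um dum] := ud _ mAB.
  apply: (Rintegral_neq0 u0 iu _ um).
  by apply: differentiable_continuous; exact/derivable1_diffP.
have bound :=
  density_distance_bound gamma0 AB B0 l0 u0 iu u1 su uA uB ud sc cs.
rewrite (spectral_cdf_density dens) Wu/=; last first.
  exact: (bounded_borel_discrepancy gamma sc cs).
rewrite (cvg_lim (@Rhausdorff R) (cvg_right_divl A0 uA)).
apply: ge_sup; first by exists `|primitive (u n) 0 - Psi gamma 0|, 0.
move=> _ [x _ <-]; apply: (le_trans (bound x)).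
rewrite lerD2l le_eqVlt; apply/orP; left; apply/eqP.
rewrite (ltr0_norm A0); field.
by rewrite !lt_eqF.
Qed.
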